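(* Let $t_0<T$ be integers and $x_0\in\mathbb{R}^n$. Assume that the random variables $w(t_0),\dots,w(T)$ are independent and identically distributed under the probability $\mathbb{P}$, with common marginal distribution $\mu$. Let $V$ be the stochastic viability value function, let $\mathfrak{U}^{\rm ad}$ be the set of admissible feedbacks, and for $\mathfrak{u}\in\mathfrak{U}^{\rm ad}$ and a scenario $w(\cdot)\in\Omega$ let $x(\cdot)=x_f[t_0,x_0,\mathfrak{u},w(\cdot)](\cdot)$ be the associated state path. Then $$V(t_0,x_0)=\max_{\mathfrak{u}\in\mathfrak{U}^{\rm ad}}\ \mathbb{E}_{\mathbb{P}}\left[\prod_{t=t_0}^{T}\mathbf{1}_{\mathbb{A}(t,w(t))}(x(t))\right].$$
   Context: Data. Integers $t_0<T$; state space $\mathbb{X}=\mathbb{R}^n$, control space $\mathbb{U}=\mathbb{R}^p$, disturbance space $\mathbb{W}=\mathbb{R}^q$. The dynamics is $x(t+1)=f(t,x(t),u(t),w(t))$ for $t=t_0,\dots,T-1$, with $f$ taking values in $\mathbb{X}$. For each $(t,x)$, $\mathbb{B}(t,x)\subset\mathbb{U}$ is a nonempty set of admissible controls. For each $t\in\{t_0,\dots,T\}$ and $w$, $\mathbb{A}(t,w)\subset\mathbb{X}$ is a nonempty, possibly uncertain, set of admissible states (the target when $t=T$). Disturbances satisfy $w(t)\in\mathbb{S}(t)\subset\mathbb{W}$. Scenarios are the sequences $w(\cdot)=(w(t_0),\dots,w(T))\in\Omega=\mathbb{S}(t_0)\times\cdots\times\mathbb{S}(T)$, and $\Omega$ carries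 the trace of the Borel $\sigma$-field and a probability $\mathbb{P}$. The i.i.d. assumption means $\mathbb{P}=\bigotimes_{t=t_0}^{T}\mu$, where $\mu$ is a common marginal distribution. $\mathbb{E}_\mu$ denotes expectation over a single disturbance $w$ with law $\mu$. $\mathbf{1}_A$ is the indicator function of $A$. Feedbacks. $\mathfrak{U}$ is the set of all measurable maps $\mathfrak{u}:\{t_0,\dots,T-1\}\times\mathbb{X}\to\mathbb{U}$, and $\mathfrak{U}^{\rm ad}=\{\mathfrak{u}\in\mathfrak{U}:\mathfrak{u}(t,x)\in\mathbb{B}(t,x)\ \text{for all }(t,x)\}$. Given $\mathfrak{u}\in\mathfrak{U}$, $w(\cdot)\in\Omega$ and $x_0\in\mathbb{X}$, the state path $x_f[t_0,x_0,\mathfrak{u},w(\cdot)]$ is the sequence $(x(t_0),\dots,x(T))$ with $x(t_0)=x_0$ and $x(t+1)=f(t,x(t),\mathfrak{u}(t,x(t)),w(t))$ for $t=t_0,\dots,T-1$. Stochastic viability value function. $V$ is defined on $\{t_0,\dots,T\}\times\mathbb{X}$ by the backward induction $$V(T,x)=\mathbb{E}_\mu\big[\mathbf{1}_{\mathbb{A}(T,w)}(x)\big],\qquad V(t,x)=\max_{u\in\mathbb{B}(t,x)}\mathbb{E}_\mu\big[\mathbf{1}_{\mathbb{A}(t,w)}(x)\,V(t+1,f(t,x,u,w))\big],\quad t=t_0,\dots,T-1.$$ Standing assumptions. The maximum in the definition of $V$ is attained for every $t$ and $x$. All objects have the appropriate measurability: $f(t,\cdot,\cdot,\cdot)$, the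 map $(x,w)\mapsto\mathbf{1}_{\mathbb{A}(t,w)}(x)$ and $V(t,\cdot)$ are measurable for every $t$, and there is a measurable feedback $\mathfrak{u}^\star\in\mathfrak{U}$ such that $\mathfrak{u}^\star(t,x)$ attains the maximum defining $V(t,x)$ for every $t\in\{t_0,\dots,T-1\}$ and $x\in\mathbb{X}$. *)

(* Defs.v *)
From HB Require Import structures.
From mathcomp Require Import all_boot all_order all_algebra.
From mathcomp Require Import all_classical all_reals all_analysis.

Set Implicit Arguments.
Unset Strict Implicit.
Unset Printing Implicit Defensive.

Import Order.TTheory GRing.Theory Num.Theory.
Import numFieldNormedType.Exports.

Local Open Scope classical_set_scope.
Local Open Scope ring_scope.

Notation borelType T := (g_sigma_algebraType (@open T)).

Definition is_maximum (R : realType) (D : set (\bar R)) (m : \bar R) : Prop :=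
  D m /\ ubound D m.

(* Measurable types are pointed in the library, so the subtype of a set carries
   a measurable structure only together with a proof that it is nonempty. *)
Definition inhabited_subtype (T : choiceType) (D : set T) (h : D !=set0) :
    Type := D.

HB.instance Definition _ (T : choiceType) (D : set T) (h : D !=set0) :=
  Choice.copy (inhabited_subtype h) D.
HB.instance Definition _ (T : choiceType) (D : set T) (h : D !=set0) :=
  isPointed.Build (inhabited_subtype h)
    (exist _ (sval (cid h)) (mem_set (svalP (cid h)))).

Definition trace_incl (T : ptopologicalType) (D : set T) (h : D !=set0)
  (x : inhabited_subtype h) : borelType T := \val x.

HB.instance Definition _ (I : Type) (T : I -> ptopologicalType) :=
  isPointed.Build (prod_topology T) (fun=> point).

(* D with the trace of the Borel sigma-field of T *)
Notation traceType h := (g_sigma_algebra_preimageType (trace_incl (h := h))).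

(* The full family is enough in the product rule: subfamilies are obtained by
   taking A i = setT outside of them. *)
Definition iid (R : realType) (d : measure_display) (Om : measurableType d)
    (d' : measure_display) (W : measurableType d') (I : finType) (P : probability Om R) (X : I -> Om -> W)
    (mu : probability W R) : Prop :=
  [/\ forall i, measurable_fun setT (X i),
      forall i A, measurable A -> P (X i @^-1` A) = mu A
    & forall A : I -> set W, (forall i, measurable (A i)) ->
        P (\bigcap_i (X i @^-1` A i)) = (\prod_i P (X i @^-1` A i))%E].

(* The times t0, ..., T are t0 + k%:Z for k : 'I_(horizon t0 T).+1; functions of
   the time are total on int and only their values on the relevant range are
   constrained or used. *)
Definition horizon (t0 T : int) : nat := `|T - t0|%N.

Notation disturbances R q t0 T :=
  {ptws 'I_(horizon t0 T).+1 -> 'rV[R]_q}.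

Definition scenarios (R : realType) (q : nat) (t0 T : int)
    (S : int -> set (borelType 'rV[R]_q)) : set (disturbances R q t0 T) :=
  [set w | forall k : 'I_(horizon t0 T).+1, S (t0 + k%:Z) (w k)].
Arguments scenarios {R q} t0 T S.

Definition disturbance (R : realType) (q : nat) (t0 T : int)
    (S : int -> set (borelType 'rV[R]_q)) (hS : scenarios t0 T S !=set0)
    (k : 'I_(horizon t0 T).+1) (w : traceType hS) : borelType 'rV[R]_q :=
  (trace_incl (h := hS) w : disturbances R q t0 T) k.
Arguments disturbance {R q t0 T S} hS k w.

Definition feedbacks (R : realType) (n p : nat) (t0 T : int) :
    set (int -> borelType 'rV[R]_n -> borelType 'rV[R]_p) :=
  [set u | forall t : int, t0 <= t < T -> measurable_fun setT (u t)].

Definition admissible_feedbacks (R : realType) (n p : nat) (t0 T : int)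
    (B : int -> borelType 'rV[R]_n -> set (borelType 'rV[R]_p)) :
    set (int -> borelType 'rV[R]_n -> borelType 'rV[R]_p) :=
  [set u | feedbacks t0 T u /\ forall (t : int) x, t0 <= t < T -> B t x (u t x)].

(* state_path f x0 u w k is the state at time t0 + k *)
Fixpoint state_path (R : realType) (n p q : nat) (t0 T : int)
    (f : int -> borelType 'rV[R]_n -> borelType 'rV[R]_p ->
         borelType 'rV[R]_q -> borelType 'rV[R]_n)
    (x0 : borelType 'rV[R]_n)
    (u : int -> borelType 'rV[R]_n -> borelType 'rV[R]_p)
    (w : 'I_(horizon t0 T).+1 -> borelType 'rV[R]_q) (k : nat) :
    borelType 'rV[R]_n :=
  if k is k'.+1 then
    let t := t0 + k'%:Z in
    let x := state_path f x0 u w k' in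
    f t x (u t x) (w (inord k'))
  else x0.

Definition stage_reward (R : realType) (n p q : nat)
    (f : int -> borelType 'rV[R]_n -> borelType 'rV[R]_p ->
         borelType 'rV[R]_q -> borelType 'rV[R]_n)
    (A : int -> borelType 'rV[R]_q -> set (borelType 'rV[R]_n))
    (mu : probability (borelType 'rV[R]_q) R)
    (V : int -> borelType 'rV[R]_n -> R)
    (t : int) (x : borelType 'rV[R]_n) (u : borelType 'rV[R]_p) : \bar R :=
  'E_mu[fun w => (\1_(A t w) x * V (t + 1) (f t x u w))%R]%E.

(* The backward induction determines V on the times t0, ..., T; it includes the
   requirement that the maxima are attained. *)
Definition viability_value_function (R : realType) (n p q : nat) (t0 T : int)
    (f : int -> borelType 'rV[R]_n -> borelType 'rV[R]_p ->
         borelType 'rV[R]_q -> borelType 'rV[R]_n)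
    (B : int -> borelType 'rV[R]_n -> set (borelType 'rV[R]_p))
    (A : int -> borelType 'rV[R]_q -> set (borelType 'rV[R]_n))
    (mu : probability (borelType 'rV[R]_q) R)
    (V : int -> borelType 'rV[R]_n -> R) : Prop :=
  (forall x, (V T x)%:E = 'E_mu[fun w => \1_(A T w) x]%E) /\
  (forall (t : int) x, t0 <= t < T ->
     is_maximum [set stage_reward f A mu V t x u | u in B t x] (V t x)%:E).

(* Main.v *)
(** Along a closed loop, the pair (product of the first k indicators, state at
    time k) is a function of the first k disturbances, hence independent of the
    later ones.  Integrating out the disturbance at time k (Tonelli) therefore
    shows that M_k = E[(product of the first k indicators) * V(t0 + k, x_k)] is
    nonincreasing in k for an admissible feedback, and constant for one that
    attains the maxima.  Now M_0 = V(t0, x0), and M_(T - t0) is the viability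
    probability. *)

Require Import Defs.
From HB Require Import structures.
From mathcomp Require Import all_boot all_order all_algebra.
From mathcomp Require Import all_classical all_reals all_analysis.
From mathcomp Require Import zify measurable_realfun.

Set Implicit Arguments.
Unset Strict Implicit.
Unset Printing Implicit Defensive.

Import Order.TTheory GRing.Theory Num.Theory.
Import numFieldNormedType.Exports.

Local Open Scope classical_set_scope.
Local Open Scope ring_scope.

(** Both sides, as functions of [Q], are measures that agree on rectangles. Uniqueness is available
    for products of two measures, so the weight [P F] is first moved onto the second factor as
    [mscale r mu]; the left side is then the pushforward by [zy] of [P] restricted to [F]. *)
Lemma joint_law_restrE (R : realType) d (Om : measurableType d)
    d1 (Z : measurableType d1) d2 (W : measurableType d2)
    (P : probability Om R) (mu : probability W R)
    (z : {mfun Om >-> Z}) (y : {mfun Om >-> W}) (F : set Om) :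
  measurable F ->
  (forall D C, measurable D -> measurable C ->
     P (z @^-1` D `&` y @^-1` C `&` F) = P (z @^-1` D) * mu C * P F)%E ->
  forall Q : set (Z * W), measurable Q ->
    (P ((fun o => (z o, y o)) @^-1` Q `&` F)
     = (distribution P z \x mu) Q * P F)%E.
Proof.
move=> mF hF Q mQ.
have mzy : measurable_fun setT (fun o => (z o, y o)).
  exact: measurable_fun_pair.
pose zy : {mfun Om >-> (Z * W)%type} :=
  HB.pack (fun o => (z o, y o)) (isMeasurableFun.Build _ _ _ _ _ mzy).
pose r : {nonneg R} := NngNum (fine_ge0 (measure_ge0 P F)).
have rE : (r%:num%:E = P F)%E by rewrite fineK// fin_num_measure.
transitivity ((distribution P z \x mscale r mu) Q)%E; last first.
  rewrite (@product_measure_unique _ _ _ _ _ _ _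
    (mscale r (distribution P z \x mu)%E)) //.
    by rewrite muleC -rE.
  move=> D C mD mC.
  transitivity (r%:num%:E * (distribution P z \x mu) (D `*` C))%E; first by [].
  by rewrite product_measure1E//= /mscale muleCA.
symmetry; apply: (@product_measure_unique _ _ _ _ _ _ _
  (pushforward (mrestr P mF) zy)) => //.
move=> D C mD mC.
by rewrite /= /mscale muleCA rE muleC muleAC [RHS]muleAC -hF.
Qed.

(** * Chains driven by i.i.d. disturbances: independence of state and future *)

Section iid_chain.
Context (R : realType) d (Om : measurableType d) d1 (Z : measurableType d1)
  d2 (W : measurableType d2).
Variables (P : probability Om R) (mu : probability W R) (N : nat).
Variable (xi : 'I_N.+1 -> Om -> W).
Hypothesis xi_iid : iid P xi mu.
Variables (z0 : Z) (phi : nat -> Z * W -> Z) (z : nat -> Om -> Z).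
Hypothesis mphi : forall k, (k < N)%N -> measurable_fun setT (phi k).
Hypothesis zE0 : z 0%N = cst z0.
Hypothesis zES : forall k, (k < N)%N ->
  z k.+1 = fun o => phi k (z k o, xi (inord k) o).

Let mxi i : measurable_fun setT (xi i). Proof. by case: xi_iid. Qed.

Let mxi_pre i C : measurable C -> measurable (xi i @^-1` C).
Proof. by move=> mC; rewrite -[X in measurable X]setTI; exact: mxi. Qed.

Let measurable_cap (C : 'I_N.+1 -> set W) : (forall i, measurable (C i)) ->
  measurable (\bigcap_i (xi i @^-1` C i)).
Proof.
move=> mC; apply: fin_bigcap_measurable; first exact: finite_finset.
by move=> i _; exact: mxi_pre.
Qed.

(** Independence of [z k] from the disturbances at times [k] and later, tested on rectangles only;
    the sides equal to [setT] drop the earlier disturbances from the intersection. *)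
Definition indep_future k := forall C : 'I_N.+1 -> set W,
  (forall i, measurable (C i)) ->
  (forall i : 'I_N.+1, (i < k)%N -> C i = setT) ->
  forall D, measurable D ->
  (P (z k @^-1` D `&` \bigcap_i (xi i @^-1` C i))
   = P (z k @^-1` D) * P (\bigcap_i (xi i @^-1` C i)))%E.

Lemma indep_future_rect k : (k <= N)%N -> indep_future k ->
  forall C : 'I_N.+1 -> set W, (forall i, measurable (C i)) ->
  (forall i : 'I_N.+1, (i < k.+1)%N -> C i = setT) ->
  forall D E, measurable D -> measurable E ->
  (P (z k @^-1` D `&` xi (inord k) @^-1` E `&` \bigcap_i (xi i @^-1` C i))
   = P (z k @^-1` D) * mu E * P (\bigcap_i (xi i @^-1` C i)))%E.
Proof.
move=> kN ik C mC CT D E mD mE.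
(* Side [k] of the rectangle [C] is trivial, so [E] can take its place: the event on [xi k] and the
   later ones form one rectangle to which [ik] applies. The product rule then splits [mu E] off
   again. *)
pose C' i := if i == inord k then E else C i.
have mC' i : measurable (C' i) by rewrite /C'; case: ifP.
have CTk : C (inord k) = setT by apply: CT; rewrite inordK.
have -> : z k @^-1` D `&` xi (inord k) @^-1` E `&` \bigcap_i (xi i @^-1` C i)
    = z k @^-1` D `&` \bigcap_i (xi i @^-1` C' i).
  rewrite -setIA; congr (_ `&` _); apply/seteqP; split=> [w [Ew Cw] i _|w C'w].
    by rewrite /C' /=; have [-> //|_] := eqP; exact: Cw.
  split=> [|i _]; first by have := C'w (inord k) I; rewrite /C' /= eqxx.
  have := C'w i I; rewrite /C' /=; case: eqP => [-> _|//].
  by rewrite CTk.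
rewrite ik//; last first.
  move=> i ltik; rewrite /C' -val_eqE /= inordK//.
  by rewrite (ltn_eqF ltik) CT// (ltn_trans ltik).
rewrite -muleA; congr (_ * _)%E.
case: xi_iid => _ Pxi Pcap.
rewrite !Pcap// (bigD1 (inord k))//= [in RHS](bigD1 (inord k))//= CTk.
rewrite preimage_setT probability_setT mul1e Pxi /C' ?eqxx//.
by congr (_ * _)%E; apply: eq_bigr => i /negPf ->.
Qed.

Lemma chain_indep_future k : (k <= N)%N ->
  measurable_fun setT (z k) /\ indep_future k.
Proof.
elim: k => [_|k IH kN].
  rewrite /indep_future zE0; split; first exact: measurable_cst.
  move=> C mC _ D mD; rewrite preimage_cst; case: ifP => _.
    by rewrite setTI probability_setT mul1e.
  by rewrite set0I measure0 mul0e.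
have [mz ik] := IH (ltnW kN).
pose zk : {mfun Om >-> Z} := HB.pack (z k) (isMeasurableFun.Build _ _ _ _ _ mz).
pose xk : {mfun Om >-> W} := HB.pack (xi (inord k))
  (isMeasurableFun.Build _ _ _ _ _ (mxi (inord k))).
have mzxi : measurable_fun setT (fun o => (z k o, xi (inord k) o)).
  by apply: measurable_fun_pair.
split; first by rewrite zES//; apply: measurableT_comp => //; exact: mphi.
move=> C mC CT D mD.
have mQ : measurable (phi k @^-1` D).
  by rewrite -[X in measurable X]setTI; exact: mphi.
have rect C' : (forall i, measurable (C' i)) ->
    (forall i : 'I_N.+1, (i < k.+1)%N -> C' i = setT) ->
    (P (z k.+1 @^-1` D `&` \bigcap_i (xi i @^-1` C' i)) =
    (distribution P zk \x mu) (phi k @^-1` D) *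
    P (\bigcap_i (xi i @^-1` C' i)))%E.
  move=> mC' C'T.
  rewrite zES// -(@joint_law_restrE _ _ _ _ _ _ _ P mu zk xk)//.
    exact: measurable_cap.
  move=> A B mA mB.
  exact: (@indep_future_rect k (ltnW kN) ik C' mC' C'T A B mA mB).
rewrite rect//; congr (_ * _)%E.
have := rect (fun=> setT) (fun=> measurableT) (fun _ _ => erefl).
by rewrite bigcapT // setIT probability_setT mule1.
Qed.

Lemma integral_past_present k (h : Z * W -> \bar R) : (k <= N)%N ->
  measurable_fun setT h -> (forall y, 0 <= h y)%E ->
  (\int[P]_o h (z k o, xi (inord k) o)
   = \int[P]_o \int[mu]_w h (z k o, w))%E.
Proof.
move=> kN mh h0; have [mz ik] := chain_indep_future kN.
pose zk : {mfun Om >-> Z} := HB.pack (z k) (isMeasurableFun.Build _ _ _ _ _ mz).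
pose xk : {mfun Om >-> W} := HB.pack (xi (inord k))
  (isMeasurableFun.Build _ _ _ _ _ (mxi (inord k))).
have mzxi : measurable_fun setT (fun o => (z k o, xi (inord k) o)).
  by apply: measurable_fun_pair.
pose zxi : {mfun Om >-> (Z * W)%type} :=
  HB.pack (fun o => (z k o, xi (inord k) o))
    (isMeasurableFun.Build _ _ _ _ _ mzxi).
transitivity (\int[distribution P zxi]_y h y)%E.
  by rewrite ge0_integral_distribution.
transitivity (\int[distribution P zk \x mu]_y h y)%E.
  (* Taking the sure event for [F] shows that the joint law of [z k] and [xi k] is a product, so
     that Tonelli applies. *)
  apply: eq_measure_integral => Q mQ _.
  have := @joint_law_restrE _ _ _ _ _ _ _ P mu zk xk setT measurableT _ Q mQ.
  rewrite setIT probability_setT mule1; apply.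
  move=> D C mD mC.
  have := @indep_future_rect k kN ik (fun=> setT) (fun=> measurableT)
    (fun _ _ => erefl) D C mD mC.
  by rewrite bigcapT// probability_setT.
rewrite fubini_tonelli1// ge0_integral_distribution//.
- exact: measurable_fun_fubini_tonelli_F.
- by move=> y; apply: integral_ge0.
Qed.

End iid_chain.

(** * Expected running products along a controlled chain *)

Section running_product.
Context (R : realType) d (Om : measurableType d) d1 (X : measurableType d1)
  d2 (W : measurableType d2).
Variables (P : probability Om R) (mu : probability W R) (N : nat).
Variable (xi : 'I_N.+1 -> Om -> W).
Hypothesis xi_iid : iid P xi mu.
Variables (x0 : X) (g : nat -> X * W -> X) (x : nat -> Om -> X).
Hypothesis mg : forall k, (k < N)%N -> measurable_fun setT (g k).
Hypothesis xE0 : x 0%N = cst x0.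
Hypothesis xES : forall k, (k < N)%N ->
  x k.+1 = fun o => g k (x k o, xi (inord k) o).
Variable a : nat -> X * W -> R.
Hypothesis ma : forall k, (k <= N)%N -> measurable_fun setT (a k).
Hypothesis a_ge0 : forall k y, 0 <= a k y.

(** The product stops before [k] because the factor [a k] already involves [xi k]. *)
Let S k o := \prod_(j < k) a j (x j o, xi (inord j) o).

Let S_ge0 k o : 0 <= S k o. Proof. exact: prodr_ge0. Qed.

(** [S k] and [x k] depend on each other, so the chain results are applied to the pair, which is
    again a chain driven by [xi]. Given the pair, [xi k] is integrated out and [S k] leaves the
    inner integral as a constant. *)
Lemma integral_running_prod k (b : X * W -> R) : (k <= N)%N ->
  measurable_fun setT b -> (forall y, 0 <= b y) ->
  [/\ measurable_fun setT (S k), measurable_fun setT (x k) &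
  (\int[P]_o (S k o * b (x k o, xi (inord k) o))%:E
   = \int[P]_o ((S k o)%:E * \int[mu]_w (b (x k o, w))%:E))%E].
Proof.
move=> kN mb b0.
pose z j o : R * X := (S j o, x j o).
pose phi j (y : (R * X) * W) : R * X :=
  (y.1.1 * a j (y.1.2, y.2), g j (y.1.2, y.2)).
have mXW : measurable_fun setT (fun y : (R * X) * W => (y.1.2, y.2)).
  apply: measurable_fun_pair; last exact: measurable_snd.
  exact: measurableT_comp measurable_snd measurable_fst.
have m11 : measurable_fun setT (fun y : (R * X) * W => y.1.1).
  exact: measurableT_comp measurable_fst measurable_fst.
have mphi j : (j < N)%N -> measurable_fun setT (phi j).
  move=> jN; apply: measurable_fun_pair.
    apply: measurable_funM => //.
    exact: measurableT_comp (ma (ltnW jN)) mXW.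
  exact: measurableT_comp (mg jN) mXW.
have z0E : z 0%N = cst (1, x0).
  by apply/funext => o; rewrite /z /S big_ord0 xE0.
have zS j : (j < N)%N -> z j.+1 = fun o => phi j (z j o, xi (inord j) o).
  by move=> jN; apply/funext => o; rewrite /z /S big_ord_recr /= xES.
have [mz _] := chain_indep_future xi_iid mphi z0E zS kN.
have mS : measurable_fun setT (S k).
  exact: (measurableT_comp measurable_fst mz).
have mx : measurable_fun setT (x k).
  exact: (measurableT_comp measurable_snd mz).
split=> //.
(* The first coordinate of an arbitrary state of the chain z may be negative,
   while integral_past_present wants a nonnegative function of that state. *)
pose h (y : (R * X) * W) := (Num.max y.1.1 0 * b (y.1.2, y.2))%:E.
have hE o w : h (z k o, w) = (S k o * b (x k o, w))%:E.
  by congr (_ * _)%:E; apply/max_idPl; exact: S_ge0.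
have mh : measurable_fun setT h.
  apply/measurable_EFinP/measurable_funM.
    by apply: measurable_maxr.
  exact: measurableT_comp mb mXW.
have h0 y : (0 <= h y)%E by rewrite lee_fin mulr_ge0// le_max lexx orbT.
have := integral_past_present xi_iid mphi z0E zS kN mh h0.
under eq_integral do rewrite hE.
move=> ->; apply: eq_integral => o _.
under eq_integral do rewrite hE EFinM.
rewrite ge0_integralZl_EFin//.
  by move=> w _; rewrite lee_fin.
apply/measurable_EFinP.
exact: (measurableT_comp mb (pair1_measurable (x k o))).
Qed.

Variable v : nat -> X -> R.
Hypothesis mv : forall k, (k <= N)%N -> measurable_fun setT (v k).
Hypothesis v_ge0 : forall k y, (k <= N)%N -> 0 <= v k y.
Hypothesis vN : forall y, (v N y)%:E = (\int[mu]_w (a N (y, w))%:E)%E.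

Let b k (y : X * W) : R := a k y * v k.+1 (g k y).
Let reward k (y : X) : \bar R := (\int[mu]_w (b k (y, w))%:E)%E.
Let M k : \bar R := (\int[P]_o (S k o * v k (x k o))%:E)%E.

Let b_ge0 k y : (k < N)%N -> 0 <= b k y.
Proof. by move=> kN; rewrite mulr_ge0// v_ge0. Qed.

Let mb k : (k < N)%N -> measurable_fun setT (b k).
Proof.
move=> kN; apply: measurable_funM; first by apply: ma; exact: ltnW.
exact: measurableT_comp (mv kN) (mg kN).
Qed.

Let M0 : M 0%N = (v 0%N x0)%:E.
Proof.
transitivity (\int[P]_o cst (v 0%N x0)%:E o)%E.
  by apply: eq_integral => o _; rewrite /S big_ord0 mul1r xE0.
by rewrite integral_cst// /= [P setT]probability_setT mule1.
Qed.

(** [xi k] enters both the new factor and the next state; [b k] gathers the two, so that one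
    integration removes it. *)
Let MS k : (k < N)%N ->
  M k.+1 = (\int[P]_o ((S k o)%:E * reward k (x k o)))%E.
Proof.
move=> kN.
have [_ _ <-] := integral_running_prod (ltnW kN) (mb kN) (fun y => b_ge0 y kN).
by apply: eq_integral => o _; rewrite /S big_ord_recr/= -mulrA /b xES.
Qed.

(** The last factor [a N] involves [xi N], on which no state depends; integrating it out leaves
    [v N] by [vN]. *)
Let MN : (\int[P]_o (\prod_(k < N.+1) a k (x k o, xi k o))%:E)%E = M N.
Proof.
transitivity (\int[P]_o (S N o * a N (x N o, xi (inord N) o))%:E)%E.
  apply: eq_integral => o _; congr _%:E.
  transitivity (S N.+1 o); last by rewrite /S big_ord_recr.
  by apply: eq_bigr => k _; rewrite inord_val.
have [_ _ ->] := integral_running_prod (leqnn N) (ma (leqnn N)) (a_ge0 N).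
by apply: eq_integral => o _; rewrite EFinM vN.
Qed.

Lemma running_product_le :
  (forall k y, (k < N)%N ->
     \int[mu]_w (a k (y, w) * v k.+1 (g k (y, w)))%:E <= (v k y)%:E)%E ->
  (\int[P]_o (\prod_(k < N.+1) a k (x k o, xi k o))%:E <= (v 0%N x0)%:E)%E.
Proof.
move=> rv; rewrite MN -M0.
suff le_M k : (k <= N)%N -> (M k <= M 0%N)%E by exact: le_M.
elim: k => // k IH kN; apply: le_trans (IH (ltnW kN)); rewrite MS//.
have [mS mx _] := integral_running_prod (ltnW kN) (mb kN) (fun y => b_ge0 y kN).
apply: ge0_le_integral => //.
- move=> o _; rewrite mule_ge0 ?lee_fin//.
  by apply: integral_ge0 => w _; rewrite lee_fin b_ge0.
- apply: emeasurable_funM; first exact/measurable_EFinP.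
  apply: measurableT_comp mx.
  (* [reward k] is a partial integral of [b k], so Tonelli gives its measurability. *)
  apply: (measurable_fun_fubini_tonelli_F (EFin \o b k)).
    by apply/measurable_EFinP; exact: mb.
  by move=> y; rewrite /= lee_fin b_ge0.
- by apply/measurable_EFinP/measurable_funM => //;
     exact: measurableT_comp (mv (ltnW kN)) mx.
- by move=> o _; rewrite EFinM lee_wpmul2l ?lee_fin//; exact: rv.
Qed.

Lemma running_product_eq :
  (forall k y, (k < N)%N ->
     \int[mu]_w (a k (y, w) * v k.+1 (g k (y, w)))%:E = (v k y)%:E)%E ->
  (\int[P]_o (\prod_(k < N.+1) a k (x k o, xi k o))%:E = (v 0%N x0)%:E)%E.
Proof.
move=> rv; rewrite MN -M0.
suff eq_M k : (k <= N)%N -> (M k = M 0%N)%E by exact: eq_M.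
elim: k => // k IH kN; rewrite -(IH (ltnW kN)) MS//.
by apply: eq_integral => o _; rewrite EFinM -rv.
Qed.

End running_product.

(** * Application to the viability value function *)

Theorem proposition1 (R : realType) (n p q : nat) (t0 T : int) (ht : t0 < T)
    (f : int -> borelType 'rV[R]_n -> borelType 'rV[R]_p ->
         borelType 'rV[R]_q -> borelType 'rV[R]_n)
    (B : int -> borelType 'rV[R]_n -> set (borelType 'rV[R]_p))
    (A : int -> borelType 'rV[R]_q -> set (borelType 'rV[R]_n))
    (S : int -> set (borelType 'rV[R]_q))
    (hB : forall (t : int) x, t0 <= t < T -> B t x !=set0)
    (hA : forall (t : int) w, t0 <= t <= T -> A t w !=set0)
    (hS : scenarios t0 T S !=set0)
    (P : probability (traceType hS) R)
    (mu : probability (borelType 'rV[R]_q) R)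
    (hiid : iid P (disturbance hS) mu)
    (V : int -> borelType 'rV[R]_n -> R)
    (hV : viability_value_function t0 T f B A mu V)
    (mf : forall t : int, t0 <= t < T ->
       measurable_fun setT
         (fun z : borelType 'rV[R]_n * borelType 'rV[R]_p * borelType 'rV[R]_q =>
            f t z.1.1 z.1.2 z.2))
    (mA : forall t : int, t0 <= t <= T ->
       measurable_fun setT
         (fun z : borelType 'rV[R]_n * borelType 'rV[R]_q =>
            \1_(A t z.2) z.1 : R))
    (mV : forall t : int, t0 <= t <= T -> measurable_fun setT (V t))
    (hstar : exists2 ustar, feedbacks t0 T ustar &
       forall (t : int) x, t0 <= t < T ->
         B t x (ustar t x) /\
         stage_reward f A mu V t x (ustar t x) = (V t x)%:E)
    (x0 : borelType 'rV[R]_n) :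
  is_maximum
    [set 'E_P[fun w => (\prod_(k < (horizon t0 T).+1)
                \1_(A (t0 + k%:Z) (disturbance hS k w))
                   (state_path f x0 u (disturbance hS ^~ w) k))%R]%E
      | u in admissible_feedbacks t0 T B]
    (V t0 x0)%:E.
Proof.
have [VT Vt] := hV; have [us mus husV] := hstar.
pose N := horizon t0 T.
have TE : T = t0 + N%:Z by rewrite /N /horizon; lia.
have range_lt k : (k < N)%N -> t0 <= t0 + k%:Z < T by rewrite TE; lia.
have range_le k : (k <= N)%N -> t0 <= t0 + k%:Z <= T by rewrite TE; lia.
have timeS k : t0 + k.+1%:Z = t0 + k%:Z + 1 by lia.
(* Nonnegativity of [V] comes from its recursion, by backward induction: [j] counts the steps left
   before [T], and each earlier value is the expectation attained by [us]. *)
have V_ge0 j : (j <= N)%N -> forall x, 0 <= V (t0 + (N - j)%N%:Z) x.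
  elim: j => [_|j IH jN] x.
    rewrite subn0 -TE -lee_fin VT; apply: expectation_ge0 => w.
    by rewrite indicE.
  rewrite -lee_fin; have [|_ <-] := husV (t0 + (N - j.+1)%N%:Z) x.
    by apply: range_lt; lia.
  apply: expectation_ge0 => w; rewrite mulr_ge0 ?indicE//.
  rewrite -timeS (_ : (N - j.+1).+1 = N - j)%N; last by lia.
  by apply: IH; lia.
have {}V_ge0 k : (k <= N)%N -> forall x, 0 <= V (t0 + k%:Z) x.
  by move=> kN x; rewrite -(subKn kN); apply: V_ge0; lia.
pose a k (y : borelType 'rV[R]_n * borelType 'rV[R]_q) : R :=
  \1_(A (t0 + k%:Z) y.2) y.1.
have a_ge0 k y : 0 <= a k y by rewrite /a indicE.
have ma k : (k <= N)%N -> measurable_fun setT (a k).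
  by move=> kN; exact: mA _ (range_le _ kN).
have mg (u : int -> borelType 'rV[R]_n -> borelType 'rV[R]_p) k :
    feedbacks t0 T u -> (k < N)%N ->
    measurable_fun setT (fun y : borelType 'rV[R]_n * borelType 'rV[R]_q =>
      f (t0 + k%:Z) y.1 (u (t0 + k%:Z) y.1) y.2).
  move=> u_fb kN.
  apply: (measurableT_comp (mf _ (range_lt _ kN))
    (g := fun y : borelType 'rV[R]_n * borelType 'rV[R]_q =>
      ((y.1, u (t0 + k%:Z) y.1), y.2))).
  apply: measurable_fun_pair; last exact: measurable_snd.
  apply: measurable_fun_pair; first exact: measurable_fst.
  exact: measurableT_comp (u_fb _ (range_lt _ kN)) measurable_fst.
have mVt k : (k <= N)%N -> measurable_fun setT (V (t0 + k%:Z)).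
  by move=> kN; exact: mV (range_le _ kN).
have VN y : (V (t0 + N%:Z) y)%:E = (\int[mu]_w (a N (y, w))%:E)%E.
  by rewrite -TE VT unlock; apply: eq_integral => w _; rewrite /a -TE.
have rewardE (u : int -> borelType 'rV[R]_n -> borelType 'rV[R]_p) k y :
    (\int[mu]_w (a k (y, w) * V (t0 + k.+1%:Z)
      (f (t0 + k%:Z) y (u (t0 + k%:Z) y) w))%:E)%E
    = stage_reward f A mu V (t0 + k%:Z) y (u (t0 + k%:Z) y).
  by rewrite /stage_reward unlock timeS.
(* Writing [t0] as [t0 + 0] matches [V] at the initial time with the member of index 0 of the family
   [V (t0 + k%:Z)]. The maximum is attained at [us], for which each stage is an equality. *)
rewrite -[t0 in (V t0 x0)%:E]addr0; split.
  exists us; first by split=> // t y tT; have [] := husV t y tT.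
  rewrite unlock.
  apply: (running_product_eq (x0 := x0)
    (x := fun k o => state_path f x0 us (disturbance hS ^~ o) k) hiid
    (fun k => mg us k mus) _ _ ma a_ge0 mVt
    (fun k y kN => V_ge0 k kN y) VN) => // k y kN.
  by rewrite rewardE; have [] := husV _ y (range_lt _ kN).
move=> _ [u [u_fb uB] <-]; rewrite unlock.
apply: (running_product_le (x0 := x0)
    (x := fun k o => state_path f x0 u (disturbance hS ^~ o) k) hiid
    (fun k => mg u k u_fb) _ _ ma a_ge0 mVt
  (fun k y kN => V_ge0 k kN y) VN) => // k y kN.
(* For any admissible [u], the control it picks is one candidate in the maximum that defines [V],
   which gives the inequality at each stage. *)
rewrite rewardE; have [_] := Vt _ y (range_lt _ kN); apply.
by exists (u (t0 + k%:Z) y) => //; exact: uB (range_lt _ kN).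
Qed.
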